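(* Let $n,k\in\mathbb{N}$, let $I\subset[n]=\{1,\dots,n\}$ with $|I|>k$, and let $A$ be an $n\times n$ matrix. Then $$\sum_{w\in\mathfrak{S}_n(I)}\det\nolimits_k(A\cdot w)=\sum_{w\in\mathfrak{S}_n(I)}\det\nolimits_k(w\cdot A)=0 .$$ In particular, if $k+1$ column vectors (or $k+1$ row vectors) of $A$ are equal, then $\det_k A=0$.
   Context: Matrices have entries in a commutative $\mathbb{C}$-algebra. $\mathfrak{S}_n$ is the symmetric group on $[n]$ and $\nu_n(w)$ is the number of cycles of $w\in\mathfrak{S}_n$ (fixed points included). For $\alpha\in\mathbb{C}$ and $A=(a_{ij})_{1\le i,j\le n}$, the $\alpha$-determinant is $\det^{(\alpha)}A=\sum_{w\in\mathfrak{S}_n}\alpha^{n-\nu_n(w)}a_{w(1)1}\cdots a_{w(n)n}$ (with $0^0=1$), and $\det_k A:=\det^{(-1/k)}A$ for $k\in\mathbb{N}=\{1,2,\dots\}$. For $I\subset[n]$, $\mathfrak{S}_n(I)=\{w\in\mathfrak{S}_n : x\notin I\Rightarrow w(x)=x\}$. For $w\in\mathfrak{S}_n$, $w\cdot A=(a_{w^{-1}(i)j})_{i,j}$ and $A\cdot w=(a_{i\,w(j)})_{i,j}$. *)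

(* Defs.v *)
From mathcomp Require Import all_boot all_order all_fingroup all_algebra.
From mathcomp Require Import reals.
From mathcomp Require Export complex.

Set Implicit Arguments.
Unset Strict Implicit.
Unset Printing Implicit Defensive.

Import GRing.Theory.
Local Open Scope ring_scope.

(* [#|porbits w|] counts all orbits of [w], singletons included, and is at
   most [n], so the truncated subtraction is the true one.  Since
   [x ^+ 0 = 1] for every [x], the convention 0^0 = 1 holds. *)
Definition alpha_det (C : fieldType) (B : comAlgType C) (n : nat)
    (alpha : C) (A : 'M[B]_n) : B :=
  \sum_(w : 'S_n) alpha ^+ (n - #|porbits w|) *: \prod_(j < n) A (w j) j.

Definition det_k (C : fieldType) (B : comAlgType C) (n : nat)
    (k : nat) (A : 'M[B]_n) : B :=
  alpha_det (- (k%:R)^-1) A.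

(* In terms of entries, [perm_actl w A i j = A (w^-1 i) j] and
   [perm_actr A w i j = A i (w j)]. *)
Definition perm_actl (B : Type) (n : nat) (w : 'S_n) (A : 'M[B]_n) : 'M[B]_n :=
  row_perm (w^-1)%g A.

Definition perm_actr (B : Type) (n : nat) (A : 'M[B]_n) (w : 'S_n) : 'M[B]_n :=
  col_perm w A.

(* Main.v *)
Require Import Defs.
From mathcomp Require Import all_boot all_order all_fingroup all_algebra.
From mathcomp Require Import reals.

Set Implicit Arguments.
Unset Strict Implicit.
Unset Printing Implicit Defensive.

Import GRing.Theory.
Local Open Scope ring_scope.

(** Expanding [det_k (A . w)] and reindexing shows that the sum over [w] in the
    Young subgroup S(I) is a combination of the monomials
    [\prod_j A (u j) j] with coefficients
    [\sum_(s in S(I)) alpha ^+ l (s * u)], where [alpha = - k^-1] and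
    [l s = n - #cycles s] is the least number of transpositions whose product
    is [s].  It is enough to see that each such coefficient vanishes as soon
    as [#|I| > k].

    The coefficient depends only on the coset [S(I) u].  Multiplying by the
    transposition of two points of a common cycle splits that cycle, so a
    representative of the coset with the largest number of cycles has all
    points of [I] in distinct cycles ([ex_scattered]).  For such a [u] the
    group S(I) only merges cycles, in the same way as it merges
    fixed points, and the classical identity
    [\sum_(s in S_m) alpha ^+ l s = \prod_(i < m) (1 + i alpha)] carries over
    with the extra factor [alpha ^+ l u] ([sum_scattered]): adding a point to
    a set of [m] points either leaves its cycle alone or merges it with the
    cycle of one of the [m] others at the cost of one factor [alpha].  For
    [alpha = - k^-1] the factor of index [i = k] is zero.

    Rows reduce to columns by transposition, because a permutation and its
    inverse have the same cycles.  If the columns indexed by [J] are equal,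
    then every term of the sum over S(J) is [det_k A], so that
    [#|J|`! * det_k A = 0], and the factorial is invertible over the complex
    numbers. *)

(** * Cycles and transpositions *)

Section ReflectionLength.

Variable T : finType.
Implicit Types (s u : {perm T}) (I : {set T}) (a x y : T).

Definition refl_length s := (#|T| - #|porbits s|)%N.

Lemma refl_lengthV s : refl_length s^-1 = refl_length s.
Proof. by rewrite /refl_length porbitsV. Qed.

Lemma refl_length_merge s x y :
  x \notin porbit s y -> refl_length (tperm x y * s) = (refl_length s).+1.
Proof.
move=> xNsy; have xy : x != y by apply: contraNneq xNsy => ->; apply: porbit_id.
have := porbits_mul_tperm s x y; rewrite xNsy xy /= addn2 addn1 => -[ts].
have le_sT : (#|porbits s| <= #|T|)%N := leq_imset_card _ _.
by rewrite /refl_length -subSn // -ts subSS.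
Qed.

Lemma card_porbits_split s x y :
  x != y -> x \in porbit s y -> (#|porbits s| < #|porbits (tperm x y * s)|)%N.
Proof.
move=> xy sxy; have := porbits_mul_tperm s x y.
by rewrite sxy xy /= addn0 addn1 => ->.
Qed.

Lemma porbit_mull_fixed s u a :
  {in porbit u a, forall x, s x = x} -> porbit (s * u) a = porbit u a.
Proof.
move=> fix_s; have su i : ((s * u) ^+ i)%g a = (u ^+ i)%g a.
  elim: i => [|i IHi]; first by rewrite !expg0.
  by rewrite !expgSr !permM IHi fix_s ?mem_porbit.
apply/setP=> x.
by apply/porbitP/porbitP=> -[i ->]; exists i; rewrite su.
Qed.

(** The left cosets of the stabilizer S(I \ a) in S(I) are represented by the
    transpositions [tperm a i], according to the preimage [i] of [a]. *)
Lemma big_perm_on_tperm (R : nmodType) I a (F : {perm T} -> R) : a \in I ->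
  \sum_(s | perm_on I s) F s =
  \sum_(i in I) \sum_(s | perm_on (I :\ a) s) F (tperm a i * s)%g.
Proof.
move=> aI.
rewrite (partition_big (fun s : {perm T} => s^-1%g a) (mem I)) /=; last first.
  by move=> s sI; rewrite perm_closed ?perm_onV.
apply: eq_bigr => i iI.
rewrite (reindex_inj (mulgI (tperm a i))) /=; apply: eq_bigl => s.
have tI : perm_on I (tperm a i).
  apply/subsetP=> x; rewrite inE; case: tpermP => [->|->|_ _] //.
  by rewrite eqxx.
apply/andP/idP => [[tsI /eqP tsa]|sI].
  have sI : perm_on I s.
    by rewrite -[s](mulKg (tperm a i)) perm_onM ?perm_onV.
  have sa : s a = a.
    by have /(canRL (permKV _)) := tsa; rewrite permM tpermR.
  apply/subsetP=> x sx; rewrite !inE (subsetP sI) // andbT.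
  by apply: contraNneq sx => ->; rewrite sa.
split.
  by rewrite perm_onM //; apply: subset_trans sI (subD1set _ _).
apply/eqP/(canLR (permK _)); rewrite permM tpermR.
by rewrite (out_perm sI) // !inE eqxx.
Qed.

Definition scattered u I := {in I &, forall x y, x \in porbit u y -> x = y}.

(** Among the elements of the coset S(I) u, one with the most cycles cannot
    have a cycle with two points of [I], since that cycle could be split. *)
Lemma ex_scattered u I : exists2 s, perm_on I s & scattered (s * u) I.
Proof.
have [s sI smax] := arg_maxnP (fun s => #|porbits (s * u)|) (perm_on1 I).
exists s => // x y xI yI xy; apply: contraTeq isT => neq_xy.
have tI : perm_on I (tperm x y).
  by apply: subset_trans (tperm_on x y) _; apply/subsetP=> z /set2P[] ->.
have := smax _ (perm_onM tI sI).
by rewrite /= -mulgA leqNgt card_porbits_split.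
Qed.

(** * The generating polynomial of a coset of S(I) *)

Lemma sum_scattered (R : comNzRingType) (alpha : R) u I : scattered u I ->
  \sum_(s | perm_on I s) alpha ^+ refl_length (s * u) =
  alpha ^+ refl_length u * \prod_(i < #|I|) (1 + i%:R * alpha).
Proof.
have [m] := ubnP #|I|; elim: m => // m IHm in I *; rewrite ltnS => leIm uI.
have [->|[a aI]] := set_0Vmem I.
  rewrite cards0 big_ord0 mulr1 (big_pred1 1%g) ?mul1g // => s /=.
  by apply/idP/eqP => [sI|->]; rewrite ?perm_on1 // (perm_on_id sI) ?cards0.
have uIa : scattered u (I :\ a).
  by move=> x y /setD1P[_ xI] /setD1P[_ yI]; apply: uI.
have cardIa : #|I| = #|I :\ a|.+1 by rewrite (cardsD1 a) aI.
rewrite (big_perm_on_tperm _ aI) exchange_big /= cardIa big_ord_recr /= mulrA.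
rewrite -IHm -?cardIa // mulr_suml; apply: eq_bigr => s sIa.
(* The cycle of [a] in [u] contains no other point of [I], so [s] leaves it
   unchanged. *)
have su_a : porbit (s * u) a = porbit u a.
  apply: porbit_mull_fixed => x ux; apply: (out_perm sIa).
  by apply/setD1P=> -[xa xI]; case/eqP: xa; apply: uI.
rewrite (bigD1 a) //= tperm1 mul1g mulrDr mulr1; congr (_ + _).
under eq_bigr => i /andP[iI ia].
  rewrite -mulgA refl_length_merge; last first.
    by rewrite porbit_sym su_a; apply: contraNN ia => /uI->.
  over.
rewrite sumr_const mulrCA mulr_natl -exprSr; congr (_ *+ _).
by apply: eq_card => i; rewrite !inE andbC.
Qed.

Lemma sum_perm_on_eq0 (R : comNzRingType) (alpha : R) (k : nat) u I :
  1 + k%:R * alpha = 0 -> (k < #|I|)%N ->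
  \sum_(s | perm_on I s) alpha ^+ refl_length (s * u) = 0.
Proof.
move=> alpha_k ltkI; have [t tI tuI] := ex_scattered u I.
rewrite (reindex_inj (mulIg t)) /=.
under eq_bigl => s.
  rewrite (_ : perm_on I _ = perm_on I s); first over.
  apply/idP/idP => sI; last exact: perm_onM.
  by rewrite -[s](mulgK t) perm_onM ?perm_onV.
under eq_bigr do rewrite -mulgA.
rewrite sum_scattered //.
by rewrite (bigD1 (Ordinal ltkI)) //= alpha_k mul0r mulr0.
Qed.

End ReflectionLength.

(** * Symmetrized alpha-determinants *)

Section AlphaDet.

Variables (C : fieldType) (B : comAlgType C) (n : nat) (alpha : C).
Implicit Types (A : 'M[B]_n) (w : 'S_n).

Lemma alpha_detE A :
  alpha_det alpha A =
  \sum_(w : 'S_n) alpha ^+ refl_length w *: \prod_j A (w j) j.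
Proof. by rewrite /refl_length card_ord. Qed.

Lemma alpha_det_tr A : alpha_det alpha A^T = alpha_det alpha A.
Proof.
rewrite !alpha_detE (reindex_inj invg_inj) /=; apply: eq_bigr => w _.
rewrite refl_lengthV (reindex_inj (@perm_inj _ w)) /=.
by under eq_bigr do rewrite mxE permK.
Qed.

Lemma alpha_det_actr A w :
  alpha_det alpha (perm_actr A w) =
  \sum_(u : 'S_n) alpha ^+ refl_length (w * u) *: \prod_j A (u j) j.
Proof.
rewrite alpha_detE (reindex_inj (mulgI w)) /=; apply: eq_bigr => u _.
rewrite [in RHS](reindex_inj (@perm_inj _ w)) /=.
by under eq_bigr do rewrite mxE permM.
Qed.

Lemma perm_actl_tr A w : perm_actl w A = (perm_actr A^T w^-1)^T.
Proof. by apply/matrixP=> i j; rewrite !mxE. Qed.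

Lemma sum_alpha_det_actl (I : {set 'I_n}) A :
  \sum_(w : 'S_n | perm_on I w) alpha_det alpha (perm_actl w A) =
  \sum_(w : 'S_n | perm_on I w) alpha_det alpha (perm_actr A^T w).
Proof.
rewrite (reindex_inj invg_inj) /=; apply: eq_big => [w|w _].
  by apply/idP/idP => /perm_onV; rewrite ?invgK.
by rewrite perm_actl_tr invgK alpha_det_tr.
Qed.

Lemma sum_alpha_det_actr_eq0 (k : nat) (I : {set 'I_n}) A :
  1 + k%:R * alpha = 0 -> (k < #|I|)%N ->
  \sum_(w : 'S_n | perm_on I w) alpha_det alpha (perm_actr A w) = 0.
Proof.
move=> alpha_k ltkI; under eq_bigr do rewrite alpha_det_actr.
rewrite exchange_big big1 //= => u _.
by rewrite -scaler_suml (sum_perm_on_eq0 _ alpha_k) ?scale0r.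
Qed.

Lemma alpha_det_eq_cols (k : nat) (J : {set 'I_n}) A :
  1 + k%:R * alpha = 0 -> (k < #|J|)%N -> #|J|`!%:R != 0 :> C ->
  {in J &, forall i j, col i A = col j A} -> alpha_det alpha A = 0.
Proof.
move=> alpha_k ltkJ fact_neq0 eqJ.
have := sum_alpha_det_actr_eq0 A alpha_k ltkJ.
have -> : \sum_(w : 'S_n | perm_on J w) alpha_det alpha (perm_actr A w) =
          \sum_(w : 'S_n | perm_on J w) alpha_det alpha A.
  apply: eq_bigr => w wJ; congr alpha_det; apply/matrixP=> i j; rewrite mxE.
  have [jJ|jJ] := boolP (j \in J); last by rewrite (out_perm wJ).
  have /matrixP/(_ i 0) : col (w j) A = col j A by apply: eqJ; rewrite ?perm_closed.
  by rewrite !mxE.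
rewrite sumr_const card_perm -scaler_nat => /eqP.
by rewrite scaler_eq0 (negPf fact_neq0) => /eqP.
Qed.

End AlphaDet.

Theorem lemma2p3 (R : realType) (B : comAlgType R[i]) (n k : nat)
    (n_gt0 : (0 < n)%N) (k_gt0 : (0 < k)%N) (A : 'M[B]_n) :
  (forall I : {set 'I_n}, (k < #|I|)%N ->
     \sum_(w : 'S_n | perm_on I w) det_k k (perm_actr A w)
       = \sum_(w : 'S_n | perm_on I w) det_k k (perm_actl w A)
     /\ \sum_(w : 'S_n | perm_on I w) det_k k (perm_actl w A) = 0)
  /\
  (forall J : {set 'I_n}, #|J| = k.+1 ->
     {in J &, forall i j, col i A = col j A}
     \/ {in J &, forall i j, row i A = row j A} ->
     det_k k A = 0).
Proof.
have alpha_k : 1 + k%:R * (- k%:R^-1) = 0 :> R[i].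
  by rewrite mulrN divff ?subrr // Num.Theory.pnatr_eq0 -lt0n.
rewrite /det_k; split=> [I ltkI|J cardJ eqJ].
  by rewrite sum_alpha_det_actl !(sum_alpha_det_actr_eq0 _ alpha_k).
have ltkJ : (k < #|J|)%N by rewrite cardJ.
have factJ : #|J|`!%:R != 0 :> R[i].
  by rewrite Num.Theory.pnatr_eq0 -lt0n fact_gt0.
case: eqJ => eqJ; first exact: alpha_det_eq_cols alpha_k ltkJ factJ eqJ.
rewrite -alpha_det_tr; apply: alpha_det_eq_cols alpha_k ltkJ factJ _.
by move=> i j iJ jJ; rewrite -!tr_row (eqJ i j).
Qed.
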